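(* Consider a unit capacity market: a finite set $I$ of $N$ agents and a set $O$ of $N$ objects, each object having capacity $1$. For every ordering (bijection) $f:\{1,\dots,N\}\to I$ of the agents, the rank-minimizing serial dictatorship (RM-SD) mechanism with ordering $f$ is not obviously manipulable.
   Context: Preferences: each agent $i\in I$ has a strict preference relation (type) $\succ_i$, a strict linear ranking of $O$; a preference profile is $\succ_I=(\succ_i,\succ_{-i})$, and all profiles of strict rankings are allowed. Write $o\succsim_i o'$ if $o\succ_i o'$ or $o=o'$. The rank of $o$ for an agent with preference $\succ_i$ is $r_i(o)=|\{o'\in O: o'\succsim_i o\}|$ (favorite object has rank 1). Allocations: an allocation is a function $\alpha:I\to O$, $i\mapsto\alpha_i$, assigning each object to at most as many agents as its capacity (here $1$). $\mathcal A$ is the set of all allocations. At a profile $\succ_I$, the average rank of $\alpha$ is $\bar r(\alpha)=\frac1N\sum_{i\in I}r_i(\alpha_i)$, and $\bar{\mathcal A}(\succ_I)=\{\alpha\in\mathcal A:\bar r(\alpha)\le\bar r(\alpha')\ \forall\alpha'\in\mathcal A\}$ is the set of rank-minimizing allocations. RM-SD with ordering $f$: for $A'\subseteq\mathcal A$ let $Top_{\succ_i}(A')=\{\alpha\in A':\alpha_i\succsim_i\hat\alpha_i\text{ for all }\hat\alpha\in A'\}$. Given a reported profile $\succ_I$, set $A_0=\bar{\mathcal A}(\succ_I)$ and $A_n=Top_{\succ_{f(n)}}(A_{n-1})$ for $n=1,\dots,N$. The set $A_N$ contains a unique allocation, and this allocation is the (deterministic) output of the mechanism, $\psi(\succ_I)$.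 Non-obvious manipulability (for a deterministic mechanism $\psi$ mapping profiles to allocations): let $\psi_i(\cdot)$ be the object assigned to agent $i$. $\psi$ is not obviously manipulable if for every agent $i$, every true type $\succ_i$ and every report $\succ_i'\ne\succ_i$, with $r_i$ computed using the true type $\succ_i$ throughout: (i) $\max_{\succ_{-i}}r_i(\psi_i(\succ_i,\succ_{-i}))\le\max_{\succ_{-i}}r_i(\psi_i(\succ_i',\succ_{-i}))$, and (ii) $\min_{\succ_{-i}}r_i(\psi_i(\succ_i,\succ_{-i}))\le\min_{\succ_{-i}}r_i(\psi_i(\succ_i',\succ_{-i}))$. Otherwise $\psi$ is obviously manipulable. *)

(* Defs.v *)
From HB Require Import structures.
From mathcomp Require Import all_boot all_order all_algebra.

Set Implicit Arguments.
Unset Strict Implicit.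
Unset Printing Implicit Defensive.

Import Order.TTheory GRing.Theory Num.Theory.

Section Preferences.
Variable O : finType.

Definition strict_linear (r : rel O) : bool :=
  [&& [forall x, ~~ r x x],
      [forall x, forall y, forall z, r x y ==> r y z ==> r x z] &
      [forall x, forall y, (x != y) ==> (r x y || r y x)]].

(* The graph is stored as a finite function so that preferences, and hence
   preference profiles, form a finite type. *)
Record pref := Pref {
  pref_graph : {ffun O * O -> bool};
  _ : strict_linear (fun x y => pref_graph (x, y))
}.
HB.instance Definition _ := [isSub for pref_graph].
HB.instance Definition _ := [Finite of pref by <:].

Definition prefers (p : pref) : rel O := fun x y => pref_graph p (x, y).
Definition weakly_prefers (p : pref) : rel O :=
  fun x y => prefers p x y || (x == y).

(* The favorite object has rank 1. *)
Definition rank (p : pref) (o : O) : nat :=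
  #|[set o' | weakly_prefers p o' o]|.

Lemma prefers_linear (p : pref) : strict_linear (prefers p).
Proof. by case: p. Qed.

Lemma prefers_irr (p : pref) x : prefers p x x = false.
Proof. by case/and3P: (prefers_linear p) => /forallP/(_ x)/negbTE. Qed.

Lemma prefers_trans (p : pref) : transitive (prefers p).
Proof.
case/and3P: (prefers_linear p) => _ H _ y x z xy yz.
by move/forallP/(_ x)/forallP/(_ y)/forallP/(_ z): H; rewrite xy yz.
Qed.

Lemma prefers_total (p : pref) x y : x != y -> prefers p x y || prefers p y x.
Proof.
case/and3P: (prefers_linear p) => _ _ H xy.
by move/forallP/(_ x)/forallP/(_ y): H; rewrite xy.
Qed.

Lemma weakly_prefers_trans (p : pref) : transitive (weakly_prefers p).
Proof.
move=> y x z /orP[xy|/eqP-> //] /orP[yz|/eqP <-]; rewrite /weakly_prefers ?xy //.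
by rewrite (prefers_trans xy yz).
Qed.

Lemma weakly_prefers_total (p : pref) : total (weakly_prefers p).
Proof.
move=> x y; rewrite /weakly_prefers; have [->|xy] := eqVneq x y.
  by rewrite orbT.
by rewrite !orbF prefers_total.
Qed.

Lemma weakly_prefers_anti (p : pref) : antisymmetric (weakly_prefers p).
Proof.
move=> x y /andP[/orP[xy|/eqP //] /orP[yx|/eqP //]].
by have := prefers_trans xy yx; rewrite prefers_irr.
Qed.

Lemma rank_le_card (p : pref) o : rank p o <= #|O|.
Proof. exact: max_card. Qed.

End Preferences.

Section Market.
Variables I O : finType.

Definition profile : predArgType := {ffun I -> pref O}.

(* Every object has capacity 1. *)
Record allocation := Allocation {
  alloc_fun :> {ffun I -> O};
  _ : [forall o, #|[set i | alloc_fun i == o]| <= 1]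
}.
HB.instance Definition _ := [isSub for alloc_fun].
HB.instance Definition _ := [Finite of allocation by <:].

Definition avg_rank (P : profile) (a : allocation) : rat :=
  ((\sum_(i : I) (rank (P i) (a i))%:R) / #|I|%:R)%R.

Definition rank_minimizing (P : profile) : {set allocation} :=
  [set a | [forall b, (avg_rank P a <= avg_rank P b)%R]].

Definition top (p : pref O) (i : I) (A : {set allocation}) : {set allocation} :=
  [set a in A | [forall b in A, weakly_prefers p (a i) (b i)]].

Definition rmsd_step (P : profile) (A : {set allocation}) (i : I) :=
  top (P i) i A.

(* The chain A_0, ..., A_N of the serial dictatorship; the ordering is
   indexed by 0, ..., N - 1 instead of 1, ..., N. *)
Definition rmsd_final (N : nat) (f : 'I_N -> I) (P : profile) :
    {set allocation} :=
  foldl (rmsd_step P) (rank_minimizing P) [seq f k | k <- enum 'I_N].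

Lemma top_neq0 p i A : A != set0 -> top p i A != set0.
Proof.
case/set0Pn=> a0 a0A.
have wr x : weakly_prefers p x x by rewrite /weakly_prefers eqxx orbT.
case: (@fintype.extremumP _ _ (weakly_prefers p) a0 [in A]
        (fun a : allocation => a i) wr (@weakly_prefers_trans _ p)
        (@weakly_prefers_total _ p) a0A) => a aA amax.
by apply/set0Pn; exists a; rewrite inE; apply/andP; split=> //; apply/forall_inP => b /amax.
Qed.

Lemma rank_minimizing_neq0 P (a0 : allocation) : rank_minimizing P != set0.
Proof.
apply/set0Pn; case: (@arg_minP _ _ _ a0 predT (avg_rank P) isT) => a _ amin.
by exists a; rewrite inE; apply/forallP => b; apply: amin.
Qed.

Lemma rmsd_foldl_neq0 P s A : A != set0 -> foldl (rmsd_step P) A s != set0.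
Proof. by elim: s A => //= i s IHs A A0; apply/IHs/top_neq0. Qed.

Lemma rmsd_foldl_sub P s A : foldl (rmsd_step P) A s \subset A.
Proof.
elim: s A => //= i s IHs A; apply: subset_trans (IHs _) _.
by apply/subsetP => a; rewrite inE => /andP[].
Qed.

Lemma rmsd_foldl_agree P s A a b i : i \in s ->
  a \in foldl (rmsd_step P) A s -> b \in foldl (rmsd_step P) A s -> a i = b i.
Proof.
elim: s A => //= j s IHs A; rewrite inE => /orP[/eqP->|]; last exact: IHs.
move=> /(subsetP (rmsd_foldl_sub _ _ _)) + /(subsetP (rmsd_foldl_sub _ _ _)).
rewrite !inE => /andP[aA /forall_inP amax] /andP[bA /forall_inP bmax].
by apply: (@weakly_prefers_anti _ (P j)); rewrite amax ?bmax.
Qed.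

Lemma allocation_exists : #|I| = #|O| -> exists a : allocation, true.
Proof.
move=> hIO; pose g := [ffun i : I => enum_val (cast_ord hIO (enum_rank i)) : O].
suff h : [forall o, #|[set i | g i == o]| <= 1] by exists (Allocation h).
apply/forallP => o; apply/card_le1_eqP => i j; rewrite !inE !ffunE.
by move=> /eqP<- /eqP/enum_val_inj/cast_ord_inj/enum_rank_inj.
Qed.

Lemma rmsd_final_unique (N : nat) (hI : #|I| = N) (hO : #|O| = N)
    (f : 'I_N -> I) (hf : bijective f) (P : profile) :
  exists a : allocation, rmsd_final f P == [set a].
Proof.
have [a0 _] := allocation_exists (etrans hI (esym hO)).
have /set0Pn[a aA] : rmsd_final f P != set0.
  exact/rmsd_foldl_neq0/rank_minimizing_neq0.
exists a; rewrite eqEsubset sub1set aA andbT; apply/subsetP => b bA.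
rewrite inE; apply/eqP/val_inj/ffunP => i; case: hf => g _ fK.
apply: rmsd_foldl_agree bA aA; rewrite -(fK i); apply/map_f.
by rewrite mem_enum.
Qed.

Definition rmsd (N : nat) (hI : #|I| = N) (hO : #|O| = N)
    (f : 'I_N -> I) (hf : bijective f) (P : profile) : allocation :=
  xchoose (rmsd_final_unique hI hO hf P).

Lemma rmsdE (N : nat) (hI : #|I| = N) (hO : #|O| = N)
    (f : 'I_N -> I) (hf : bijective f) (P : profile) :
  rmsd_final f P = [set rmsd hI hO hf P].
Proof. exact/eqP/(xchooseP (rmsd_final_unique hI hO hf P)). Qed.

(* Agent i has true type p and reports q. The reports of the other agents
   are all those of the profiles P with P i = q. *)
Definition worst_rank (psi : profile -> allocation) (i : I) (p q : pref O) :
    nat :=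
  \max_(P : profile | P i == q) rank p (psi P i).

(* The neutral element #|O| bounds every rank, and the range is never empty,
   so this is the true minimum (best_rankP). *)
Definition best_rank (psi : profile -> allocation) (i : I) (p q : pref O) :
    nat :=
  \big[minn/#|O|]_(P : profile | P i == q) rank p (psi P i).

Definition not_obviously_manipulable (psi : profile -> allocation) : Prop :=
  forall (i : I) (p p' : pref O), p' != p ->
    worst_rank psi i p p <= worst_rank psi i p p' /\
    best_rank psi i p p <= best_rank psi i p p'.

Lemma worst_rankP psi i p q :
  (exists2 P : profile, P i = q & worst_rank psi i p q = rank p (psi P i)) /\
  (forall P : profile, P i = q -> rank p (psi P i) <= worst_rank psi i p q).
Proof.
split=> [|P /eqP Pi]; last first.
  exact: (@leq_bigmax_cond _ _ (fun P : profile => rank p (psi P i))).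
have P0 : 0 < #|[pred P : profile | P i == q]|.
  by apply/card_gt0P; exists [ffun=> q]; rewrite inE ffunE.
have [P] := eq_bigmax_cond (fun P : profile => rank p (psi P i)) P0.
by rewrite inE => /eqP Pi e; exists P.
Qed.

Lemma best_rankP psi i p q :
  (exists2 P : profile, P i = q & best_rank psi i p q = rank p (psi P i)) /\
  (forall P : profile, P i = q -> best_rank psi i p q <= rank p (psi P i)).
Proof.
have lb (P : profile) : P i = q -> best_rank psi i p q <= rank p (psi P i).
  move=> Pi; rewrite /best_rank -big_filter.
  have: P \in [seq Q : profile <- index_enum _ | Q i == q].
    by rewrite mem_filter Pi eqxx mem_index_enum.
  elim: [seq _ <- _ | _] => //= Q s IHs; rewrite big_cons inE geq_min.
  by case/orP=> [/eqP<-|/IHs ->]; rewrite ?leqnn ?orbT.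
split=> //.
have P0 : [ffun=> q] i == q :> pref O by rewrite ffunE.
case: (@arg_minnP _ ([ffun=> q] : profile) (fun P : profile => P i == q)
        (fun P => rank p (psi P i)) P0) => P /eqP Pi Pmin.
exists P => //; apply/eqP; rewrite eqn_leq lb //= /best_rank.
elim/big_rec: _ => [|Q m /Pmin Qi Pm]; first exact: rank_le_card.
by rewrite leq_min Qi.
Qed.

End Market.

(* Main.v *)
Require Import Defs.
From mathcomp Require Import all_boot all_order all_algebra.
From mathcomp Require Import perm zify.

(** Best case: when the favorites of all agents are distinct, the unique
    rank-minimizing allocation gives agent [i] her favorite object.

    Worst case: let the other agents have distinct favorites in [O \ {o}] and
    all rank [o] last. If agent [i] does not report [o] last, then [i] gets
    [o] in every rank-minimizing allocation; so a report [p'] yields every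
    object but the one ranked last by [p'], and only the case where [p] and
    [p'] have the same last object [o] and truth-telling may yield [o] remains.
    There, swapping the objects of [i] and of the agent [j] holding the
    favorite object of [i] cannot increase the total rank, so [j] must choose
    before [i]. If now [j] has the reported favorite of [i] as favorite in the
    profile above, then the tie is broken in favor of [j] and [i] gets [o]. *)

Set Implicit Arguments.
Unset Strict Implicit.
Unset Printing Implicit Defensive.

Import Order.TTheory GRing.Theory Num.Theory.

(** * Ranks, and rankings with prescribed first and last objects *)

Section Rank.
Variable O : finType.
Implicit Types (p : pref O) (x y : O).

Lemma weakly_prefers_refl p x : weakly_prefers p x x.
Proof. by rewrite /weakly_prefers eqxx orbT. Qed.

Lemma rank_gt0 p x : 0 < rank p x.
Proof. by apply/card_gt0P; exists x; rewrite inE weakly_prefers_refl. Qed.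

Lemma rank_mono p x y : (rank p x <= rank p y) = weakly_prefers p x y.
Proof.
have le u v : weakly_prefers p u v -> rank p u <= rank p v.
  move=> uv; apply/subset_leq_card/subsetP => w; rewrite !inE => wu.
  exact: weakly_prefers_trans wu uv.
apply/idP/idP => [xy|]; last exact: le.
case/orP: (weakly_prefers_total p x y) => // yx.
(* The objects weakly above [y] are among those weakly above [x]; the rank inequality forces the two
   sets to coincide. *)
suff /subsetP/(_ x) : [set z | weakly_prefers p z x]
    \subset [set z | weakly_prefers p z y].
  by rewrite !inE => -> //; apply: weakly_prefers_refl.
suff -> : [set z | weakly_prefers p z x] = [set z | weakly_prefers p z y] by [].
apply/esym/eqP; rewrite eqEcard xy andbT; apply/subsetP => z; rewrite !inE => zy.
exact: weakly_prefers_trans zy yx.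
Qed.

Lemma rank_inj p : injective (rank p).
Proof.
by move=> x y xy; apply: (@weakly_prefers_anti _ p); rewrite -!rank_mono xy leqnn.
Qed.

Lemma rank_surj p r : 0 < r <= #|O| -> exists x, rank p x = r.
Proof.
case/andP=> r0 rO; have lt x : (rank p x).-1 < #|O|.
  by rewrite prednK ?rank_gt0 ?rank_le_card.
pose h x := Ordinal (lt x).
have h_inj : injective h.
  move=> x y /(congr1 val) /= e; apply: (@rank_inj p).
  by rewrite -(prednK (rank_gt0 p x)) e prednK ?rank_gt0.
have [g _ gK] := inj_card_bij h_inj (eq_leq (card_ord _)).
have r1 : r.-1 < #|O| by rewrite prednK.
exists (g (Ordinal r1)); have /(congr1 val) /= e := gK (Ordinal r1).
by rewrite -(prednK (rank_gt0 _ _)) e prednK.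
Qed.

Lemma strict_linear_key (h : O -> nat) : injective h ->
  strict_linear (fun x y => [ffun u => h u.1 < h u.2] (x, y)).
Proof.
move=> h_inj; apply/and3P; split.
- by apply/forallP => x; rewrite ffunE ltnn.
- do 3!apply/forallP => ?; rewrite !ffunE /=.
  by apply/implyP => xy; apply/implyP; apply: ltn_trans.
- do 2!apply/forallP => ?; rewrite !ffunE /=.
  by apply/implyP; rewrite -(inj_eq h_inj) neq_ltn.
Qed.

(** Smaller keys are better. The successor of [enum_rank] keeps 0 free for [t], and [#|O|.+1]
    exceeds every other key. *)
Definition top_bottom_key t o x : nat :=
  if x == t then 0 else if x == o then #|O|.+1 else (enum_rank x).+1.

Lemma top_bottom_key_inj t o : injective (top_bottom_key t o).
Proof.
move=> x y; rewrite /top_bottom_key.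
have lt z : enum_rank z < #|O| := ltn_ord (enum_rank z).
have [->|_] := eqVneq x t; have [->|_] := eqVneq y t => //; try by case: ifP.
have [->|_] := eqVneq x o; have [->|_] := eqVneq y o => //.
- by move=> [] e; have := lt y; rewrite -e ltnn.
- by move=> [] e; have := lt x; rewrite e ltnn.
- by move=> [] e; apply/enum_rank_inj/val_inj.
Qed.

Definition top_bottom t o : pref O :=
  Pref (strict_linear_key (@top_bottom_key_inj t o)).

Lemma top_bottomE t o x y :
  prefers (top_bottom t o) x y = (top_bottom_key t o x < top_bottom_key t o y).
Proof. by rewrite /prefers ffunE. Qed.

Lemma rank_top t o : rank (top_bottom t o) t = 1.
Proof.
apply/eqP/cards1P; exists t; apply/setP => x; rewrite !inE /weakly_prefers.
by rewrite top_bottomE {2}/top_bottom_key eqxx.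
Qed.

Lemma rank_bottom t o : t != o -> rank (top_bottom t o) o = #|O|.
Proof.
move=> to; rewrite /rank -cardsT; apply: eq_card => x; rewrite !inE.
rewrite /weakly_prefers top_bottomE /top_bottom_key (eq_sym o) (negbTE to) eqxx.
have [_|_] := eqVneq x t => //; have [_|_] := eqVneq x o; first by rewrite orbT.
by rewrite orbF ltnS (ltn_ord (enum_rank x)).
Qed.

End Rank.

(** * Total ranks, exchanges of objects and the extremal profiles *)

Section Allocations.
Variables I O : finType.
Implicit Types (P : profile I O) (a b : allocation I O) (i j k : I).

Lemma alloc_inj a : injective a.
Proof.
case: a => g /= /forallP h i j e.
by have /card_le1_eqP := h (g i); apply; rewrite inE ?e.
Qed.

Lemma alloc_permP a (s : {perm I}) :
  [forall o, #|[set i | [ffun k => a (s k)] i == o]| <= 1].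
Proof.
apply/forallP => o; apply/card_le1_eqP => i j; rewrite !inE !ffunE.
by move=> /eqP<- /eqP/alloc_inj/perm_inj.
Qed.

Definition alloc_perm a (s : {perm I}) : allocation I O :=
  Allocation (alloc_permP a s).

Lemma alloc_permE a (s : {perm I}) i : alloc_perm a s i = a (s i).
Proof. by rewrite ffunE. Qed.

Lemma rank_minimizingE P a :
  reflect (forall b, \sum_k rank (P k) (a k) <= \sum_k rank (P k) (b k))
          (a \in rank_minimizing P).
Proof.
rewrite inE; have [I0|I0] := posnP #|I|.
  have E b : \sum_k rank (P k) (b k) = 0.
    by apply: big1 => k; have := fintype0 k I0.
  apply: (iffP forallP) => _ b; first by rewrite !E.
  by rewrite /avg_rank I0 invr0 !mulr0.
apply: (iffP forallP) => le b; have := le b;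
  by rewrite /avg_rank ler_pM2r ?invr_gt0 ?ltr0n // -!natr_sum ler_nat.
Qed.

Lemma sumD2 (F : I -> nat) i j : i != j ->
  \sum_k F k = F i + (F j + \sum_(k | (k != i) && (k != j)) F k).
Proof. by move=> ij; rewrite (bigD1 i) //= (bigD1 j) // eq_sym. Qed.

Lemma rank_minimizing2 P a b i j : i != j ->
  (forall k, k != i -> k != j -> a k = b k) ->
  rank (P i) (b i) + rank (P j) (b j) <= rank (P i) (a i) + rank (P j) (a j) ->
  a \in rank_minimizing P -> b \in rank_minimizing P.
Proof.
move=> ij agree le_ba /rank_minimizingE a_min; apply/rank_minimizingE => c.
apply: leq_trans (a_min c); rewrite !(sumD2 _ ij) !addnA leq_add //.
by apply: leq_sum => k /andP[ki kj]; rewrite agree.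
Qed.

(** As long as the choosing agents get the same object from [a] and [b], the survival of [a] entails
    that of [b]. Hence [b] is still available when [j] picks. *)
Lemma rmsd_foldl_prefers P s (A : {set allocation I O}) a b j :
  j \in s -> a \in foldl (rmsd_step P) A s -> b \in A ->
  (forall k, index k s < index j s -> a k = b k) ->
  weakly_prefers (P j) (a j) (b j).
Proof.
elim: s A => //= h s IHs A; rewrite inE eq_sym => js a_fin bA.
have := subsetP (rmsd_foldl_sub _ _ _) _ a_fin.
rewrite inE => /andP[_ /forall_inP amax].
case: eqVneq js => [<- _ _|hj /= js agree]; first exact: amax.
have ah : a h = b h by apply: agree; rewrite eqxx.
apply: (IHs _ js a_fin) => [|k lt]; last by apply: agree; case: eqVneq.
by rewrite inE bA -ah; apply/forall_inP.
Qed.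

Hypothesis card_IO : #|I| = #|O|.

Lemma alloc_surj a o : exists i, a i = o.
Proof.
have [g _ gK] := inj_card_bij (@alloc_inj a) (eq_leq (esym card_IO)).
by exists (g o).
Qed.

Lemma alloc_at i (o : O) : exists a, a i = o.
Proof.
have [a _] := allocation_exists card_IO; have [m <-] := alloc_surj a o.
by exists (alloc_perm a (tperm i m)); rewrite alloc_permE tpermL.
Qed.

Lemma alloc_at2 i j (o t : O) : i != j -> o != t ->
  exists2 a : allocation I O, a i = o & a j = t.
Proof.
move=> ij ot; have [a ai] := alloc_at i o; have [m am] := alloc_surj a t.
exists (alloc_perm a (tperm j m)); rewrite alloc_permE ?tpermL //.
rewrite tpermD // 1?eq_sym //; apply: contra_neq ot => im.
by rewrite -ai -am im.
Qed.

(** The extremal profile of both cases: every agent but [i] ranks her own object under [b] first and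
    that of [i] last. *)
Definition favoring b i (p : pref O) : profile I O :=
  [ffun k => if k == i then p else top_bottom (b k) (b i)].

Lemma favoring_self b i p : favoring b i p i = p.
Proof. by rewrite ffunE eqxx. Qed.

Lemma favoring_other b i p k : k != i ->
  favoring b i p k = top_bottom (b k) (b i).
Proof. by rewrite ffunE => /negbTE->. Qed.

(** If [m] holds [b i] under [a], moving from [b] to [a] costs [m] exactly [#|O| - 1] ranks, costs
    the other agents besides [i] at least 0, and gains [i] at most [#|O| - 1]. Minimality of [a]
    makes all these bounds tight. *)
Lemma favoringP b i p a : a \in rank_minimizing (favoring b i p) ->
  a i != b i ->
  [/\ rank p (b i) = #|O|, rank p (a i) = 1 &
      forall k, k != i -> a k != b i -> a k = b k].
Proof.
move=> /rank_minimizingE/(_ b) le_ab ai; have [m am] := alloc_surj a (b i).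
have mi : m != i by apply: contra_neq ai => mi; rewrite -am mi.
have b1 k : k != i -> rank (favoring b i p k) (b k) = 1.
  by move=> ki; rewrite favoring_other // rank_top.
have mN : rank (favoring b i p m) (a m) = #|O|.
  by rewrite favoring_other // am rank_bottom // (inj_eq (@alloc_inj b)).
have im : i != m by rewrite eq_sym.
move: le_ab; rewrite !(sumD2 _ im) !favoring_self mN b1 //.
set Sa := (X in _ + (_ + X) <= _); set Sb := (X in _ <= _ + (_ + X)).
move=> le_ab.
(* The equality case of the sum bound is what later gives rank 1 to each single agent. *)
have [le_ba eq_ba] : Sb <= Sa ?= iff
    [forall (k | (k != i) && (k != m)), rank (favoring b i p k) (a k) == 1].
  apply: leqif_sum => k /andP[ki _]; rewrite b1 // eq_sym.
  exact/leqif_eq/rank_gt0.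
have := rank_gt0 p (a i); have := rank_le_card p (b i) => bO a0.
have eS : Sb == Sa by lia.
split; [lia|lia|]; move: eS; rewrite eq_ba => /forall_inP all1 k ki ak.
have km : k != m by apply: contra_neq ak => ->.
apply: (@rank_inj _ (favoring b i p k)); rewrite b1 //.
by apply/eqP/all1; rewrite ki.
Qed.

End Allocations.

(** * Outcomes of the mechanism and the two comparisons *)

Section SerialDictatorship.
Variables (N : nat) (I O : finType) (hI : #|I| = N) (hO : #|O| = N).
Variables (f : 'I_N -> I) (hf : bijective f).
Implicit Types (P : profile I O) (b : allocation I O) (i j : I) (p : pref O).
Let psi := rmsd hI hO hf.
Let s := [seq f k | k <- enum 'I_N].
Let card_IO : #|I| = #|O| := etrans hI (esym hO).

Lemma mem_order j : j \in s.
Proof. by case: hf => g _ gK; rewrite -(gK j) map_f // mem_enum. Qed.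

Lemma rmsd_rank_minimizing P : psi P \in rank_minimizing P.
Proof.
have : psi P \in rmsd_final f P by rewrite (rmsdE hI hO hf) set11.
exact/subsetP/rmsd_foldl_sub.
Qed.

Lemma rmsd_prefers P b j : b \in rank_minimizing P ->
  (forall k, index k s < index j s -> psi P k = b k) ->
  weakly_prefers (P j) (psi P j) (b j).
Proof.
move=> b_min agree; apply: rmsd_foldl_prefers b_min agree.
  exact: mem_order.
by have := rmsdE hI hO hf P; rewrite /rmsd_final => ->; rewrite set11.
Qed.

(** The second alternative matters for [N = 1], where the favorite object is also the last one. *)
Lemma rmsd_favoring b i p : rank p (b i) < N \/ rank p (b i) = 1 ->
  psi (favoring b i p) i = b i.
Proof.
move=> bi; have [//|ai] := eqVneq (psi (favoring b i p) i) (b i).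
have [bN a1 _] := favoringP card_IO (rmsd_rank_minimizing _) ai.
apply: (@rank_inj _ p); rewrite a1.
by case: bi => //; rewrite bN hO ltnn.
Qed.

Lemma rmsd_last_preceded P i : 1 < N -> rank (P i) (psi P i) = N ->
  exists j, index j s < index i s.
Proof.
move=> N1 iN; set a := psi P.
have [t t1] : exists t, rank (P i) t = 1 by apply: rank_surj; rewrite hO; lia.
have [j aj] := alloc_surj card_IO a t.
have ij : i != j by apply: contra_eq_neq iN => /(congr1 a) ->; rewrite aj t1; lia.
(* If [j] came after [i], all agents before [i] would be unaffected by the swap [c], and [i] would
   secure her favorite. *)
exists j; rewrite ltnNge leq_eqVlt; apply/negP => /orP[/eqP|lt_ij].
  by move/(index_inj i (mem_order i) (mem_order j))/eqP; apply/negP.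
pose c := alloc_perm a (tperm i j).
have ci : c i = t by rewrite alloc_permE tpermL.
have cj : c j = a i by rewrite alloc_permE tpermR.
have ck k : k != i -> k != j -> a k = c k.
  by move=> ki kj; rewrite alloc_permE tpermD // eq_sym.
have c_min : c \in rank_minimizing P.
  apply: rank_minimizing2 ij ck _ (rmsd_rank_minimizing P).
  (* The swap improves [i] by [N - 1] ranks and harms [j] by at most as much. *)
  rewrite ci cj -/a iN aj t1.
  by have := rank_le_card (P j) (a i); have := rank_gt0 (P j) t; lia.
have : weakly_prefers (P i) (psi P i) (c i).
  apply: rmsd_prefers c_min _ => k lt_ki.
  apply: ck; first by apply: contraTneq lt_ki => ->; rewrite ltnn.
  by apply: contraTneq lt_ki => ->; rewrite -leqNgt ltnW.
by rewrite -rank_mono iN ci t1; lia.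
Qed.

(** Otherwise the outcome is [b] with the objects of [i] and [j] exchanged. Then [b] has the same
    total rank, and [j], picking before [i], would enforce it. *)
Lemma rmsd_favoring_preceded b i j p :
  j != i -> index j s < index i s -> rank p (b j) = 1 ->
  psi (favoring b i p) i = b i.
Proof.
move=> ji lt_ji bj; set Q := favoring b i p; set a := psi Q.
have [//|ai] := eqVneq (a i) (b i).
have [bN a1 agree] := favoringP card_IO (rmsd_rank_minimizing Q) ai.
have aib : a i = b j by apply: (@rank_inj _ p); rewrite a1.
have aj : a j = b i.
  have [//|aj] := eqVneq (a j) (b i); have := agree j ji aj.
  by rewrite -aib => /alloc_inj ij; rewrite ij eqxx in ji.
have Qj : rank (Q j) (b j) = 1 by rewrite /Q favoring_other // rank_top.
have ab k : k != i -> k != j -> a k = b k.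
  by move=> ki kj; apply: agree; rewrite // -aj (inj_eq (@alloc_inj _ _ a)).
have b_min : b \in rank_minimizing Q.
  have ij : i != j by rewrite eq_sym.
  apply: rank_minimizing2 ij ab _ (rmsd_rank_minimizing Q).
  rewrite -/a Qj aib aj /Q favoring_self bj bN favoring_other //.
  by rewrite rank_bottom ?(inj_eq (@alloc_inj _ _ b)) // addnC.
have : weakly_prefers (Q j) (a j) (b j).
  apply: rmsd_prefers b_min _ => k lt_kj.
  apply: ab; last by apply: contraTneq lt_kj => ->; rewrite ltnn.
  by apply: contraTneq lt_kj => ->; rewrite -leqNgt ltnW.
rewrite -rank_mono Qj aj /Q favoring_other //.
rewrite rank_bottom ?(inj_eq (@alloc_inj _ _ b)) // -bN => le1.
have : rank p (b i) = rank p (b j).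
  by apply/eqP; rewrite bj eqn_leq le1 rank_gt0.
by move=> /rank_inj/alloc_inj ij; rewrite ij eqxx in ji.
Qed.

Lemma rmsd_best_rank i p : best_rank psi i p p = 1.
Proof.
have [[P _ eP] le_best] := best_rankP psi i p p.
apply/eqP; rewrite eqn_leq [X in _ && (0 < X)]eP rank_gt0 andbT.
have [t t1] : exists t, rank p t = 1.
  by apply: rank_surj; rewrite -card_IO /=; apply/card_gt0P; exists i.
have [b bi] := alloc_at card_IO i t.
apply: leq_trans (le_best (favoring b i p) (favoring_self _ _ _)) _.
by rewrite rmsd_favoring bi ?t1 //; right.
Qed.

Lemma rmsd_worst_rank i p p' : worst_rank psi i p p <= worst_rank psi i p p'.
Proof.
have [[P Pi ->] _] := worst_rankP psi i p p.
have [_ le_worst] := worst_rankP psi i p p'; set o := psi P i.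
(* It suffices that the report [p'] can yield some object that is truly no better than [o]. *)
have reach x : (exists2 Q : profile I O, Q i = p' & psi Q i = x) ->
    rank p o <= rank p x -> rank p o <= worst_rank psi i p p'.
  by case=> Q Qi <- /leq_trans; apply; apply: le_worst.
have reach_lt x : rank p' x < N -> rank p o <= rank p x ->
    rank p o <= worst_rank psi i p p'.
  move=> x_lt; apply: reach; have [b bi] := alloc_at card_IO i x.
  exists (favoring b i p'); first exact: favoring_self.
  by rewrite rmsd_favoring bi //; left.
have N0 : 0 < N by rewrite -hI; apply/card_gt0P; exists i.
have leN (q : pref O) x : rank q x <= N by rewrite -hO rank_le_card.
have [o_lt|o_last'] := ltnP (rank p' o) N; first exact: reach_lt o_lt _.
have [z zN] : exists z, rank p z = N by apply: rank_surj; rewrite hO N0 leqnn.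
have [o_lt|o_last] := ltnP (rank p o) N.
  (* Here [o] is last for [p'] but not for [p], so the truly last object [z] is not last for
     [p']. *)
  apply: (reach_lt z); last by rewrite zN.
  rewrite ltn_neqAle leN andbT; apply: contraTneq o_lt => z_last.
  suff -> : o = z by rewrite zN ltnn.
  by apply: (@rank_inj _ p'); apply/eqP; rewrite z_last eqn_leq leN.
have oN : rank p o = N by apply/eqP; rewrite eqn_leq leN.
have oN' : rank p' o = N by apply/eqP; rewrite eqn_leq leN.
have [N1|N1] := ltnP 1 N; last first.
  rewrite oN (leq_trans N1) //.
  apply: leq_trans (rank_gt0 p (psi [ffun=> p'] i)) _.
  by apply: le_worst; rewrite ffunE.
apply: (reach o) => //.
(* The order of choice does not depend on reports, so an agent found from the truthful profile [P]
   also precedes [i] under [p']. *)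
have [j lt_ji] : exists j, index j s < index i s.
  by apply: (rmsd_last_preceded (P := P) N1); rewrite Pi.
have [t t1] : exists t, rank p' t = 1 by apply: rank_surj; rewrite hO N0.
have ot : o != t by apply: contraTneq N1 => e; rewrite -oN' e t1.
have ji : j != i by apply: contraTneq lt_ji => ->; rewrite ltnn.
have ij : i != j by rewrite eq_sym.
have [b bi bj] := alloc_at2 card_IO ij ot.
exists (favoring b i p'); first exact: favoring_self.
by rewrite (rmsd_favoring_preceded ji lt_ji) ?bj.
Qed.

End SerialDictatorship.

Theorem proposition2 (N : nat) (I O : finType)
    (hI : #|I| = N) (hO : #|O| = N)
    (f : 'I_N -> I) (hf : bijective f) :
  not_obviously_manipulable (rmsd hI hO hf).
Proof.
move=> i p p' _; split; first exact: rmsd_worst_rank.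
rewrite rmsd_best_rank.
by have [[P _ ->] _] := best_rankP (rmsd hI hO hf) i p p'; apply: rank_gt0.
Qed.
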